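(* For any positive integer $m > 1$ there exists a fractional assignment $x \in [0,1]^{m \times (m-1)}$ such that for any assignment $y \in \{0,1\}^{m \times (m-1)}$, there exist some $i\in [m]$ and $t \in [m-1]$ for which \[ \Big|\sum_{j \in [t]} (x_{ij} - y_{ij}) \Big| \ge 1-\frac{1}{2m-2}. \]
   Context: $[k] := \{1,\dots,k\}$. A matrix $x \in [0,1]^{m \times n}$ is a fractional assignment if $\sum_{i \in [m]} x_{ij} = 1$ for every column $j \in [n]$. A matrix $y \in \{0,1\}^{m \times n}$ is an (integral) assignment if $\sum_{i \in [m]} y_{ij} = 1$ for every $j \in [n]$. *)

(* Defs.v *)
(* MathComp; the real numbers are an arbitrary [R : realType]. *)
From mathcomp Require Import all_boot all_order all_algebra.
From mathcomp Require Import reals.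
Set Implicit Arguments.
Unset Strict Implicit.
Unset Printing Implicit Defensive.
Import Order.TTheory GRing.Theory Num.Theory.
Local Open Scope ring_scope.

Definition fractional_assignment (R : realType) (m n : nat) (x : 'M[R]_(m, n))
    : Prop :=
  (forall i j, 0 <= x i j <= 1) /\ (forall j, \sum_(i < m) x i j = 1).

Definition assignment (R : realType) (m n : nat) (y : 'M[R]_(m, n)) : Prop :=
  (forall i j, y i j = 0 \/ y i j = 1) /\ (forall j, \sum_(i < m) y i j = 1).

(* Columns are numbered from 0, so the first t columns, [t] = {1, ..., t},
   are those with index j < t. *)
Definition prefix_discrepancy (R : realType) (m n : nat) (x y : 'M[R]_(m, n))
    (i : 'I_m) (t : nat) : R :=
  `|\sum_(j < n | (j < t)%N) (x i j - y i j)|.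

(* Main.v *)
(* Let n = m - 1 and e = 1/(2n).  The first column of x puts e on each of the
   first n rows and 1/2 on the last one; each later column puts 1/n on each of
   the first n rows.  If y misses one of the first n rows altogether, that row
   ends with discrepancy e + (n - 1)/n = 1 - e.  Otherwise the n columns of y
   are used up by the first n rows, so the first column is assigned to one of
   them, which has discrepancy 1 - e already at t = 1. *)
Require Import Defs.
From mathcomp Require Import all_boot all_order all_algebra.
From mathcomp Require Import reals.
From mathcomp Require Import ring lra.
Set Implicit Arguments.
Unset Strict Implicit.
Unset Printing Implicit Defensive.
Import Order.TTheory GRing.Theory Num.Theory.
Local Open Scope ring_scope.

(** Here $m$ is [n.+2], so the number $m - 1$ of columns is [n.+1] and column [0] exists. *)
Definition hard_matrix (R : realType) (n : nat) : 'M[R]_(n.+2, n.+1) :=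
  \matrix_(i, j)
    if i == ord_max then (if j == 0 then 2^-1 else 0)
    else (if j == 0 then (2 * n.+1%:R)^-1 else n.+1%:R^-1).

Lemma hard_matrix_fractional (R : realType) (n : nat) :
  fractional_assignment (hard_matrix R n).
Proof.
have N0 : n.+1%:R != 0 :> R by rewrite pnatr_eq0.
have N1 : 1 <= n.+1%:R :> R by rewrite ler1n.
split=> [i j|j].
  rewrite mxE; case: ifP => _; case: ifP => _; rewrite ?lexx ?ler01 //.
  - by apply/andP; split; lra.
  - by rewrite invr_ge0 invf_le1; [apply/andP; split|]; lra.
  - by rewrite invr_ge0 invf_le1; [apply/andP; split|]; lra.
rewrite big_ord_recr /= mxE eqxx.
under eq_bigr => i _ do
  rewrite mxE -val_eqE /= (ltn_eqF (ltn_ord i)).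
rewrite sumr_const card_ord -[_ *+ n.+1]mulr_natr.
(* Column [0] sums to $N/(2N) + 1/2$, every other column to $N/N + 0$. *)
by move: n.+1%:R N0 {N1} => N N0; case: ifP => _; field.
Qed.

Lemma assignment_missed_row (R : realType) (n : nat)
    (y : 'M[R]_(n.+2, n.+1)) :
  assignment y ->
  (exists2 i, i != ord_max & forall j, y i j = 0) \/
  (exists2 i, i != ord_max & y i 0 = 1).
Proof.
move=> [y01 ysum].
have y0 i j : 0 <= y i j by case: (y01 i j) => ->; rewrite ?ler01.
case: (boolP [exists i, (i != ord_max) && [forall j, y i j == 0]]).
  move=> /existsP[i /andP[ni /forallP yi]]; left; exists i => // j.
  exact/eqP.
move=> /existsPn hit; right.
have row_ge1 (i : 'I_n.+1) : 1 <= \sum_j y (widen_ord (leqnSn n.+1) i) j.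
  set k := widen_ord _ i.
  have nk : k != ord_max by rewrite -val_eqE /= (ltn_eqF (ltn_ord i)).
  move: (hit k); rewrite nk /= => /forallPn[j yj].
  rewrite (bigD1 j) //=.
  case: (y01 k j) yj => ->; first by rewrite eqxx.
  by move=> _; rewrite lerDl sumr_ge0.
(* Double counting: summed by columns, [y] has total [n.+1], and [row_ge1] makes the rows before the
   last exhaust it. *)
have total : \sum_i \sum_j y i j = n.+1%:R.
  rewrite exchange_big /=; under eq_bigr do rewrite ysum.
  by rewrite sumr_const card_ord.
have last_le0 : \sum_j y ord_max j <= 0.
  move: total; rewrite big_ord_recr /=.
  have : n.+1%:R <= \sum_(i < n.+1) \sum_j y (widen_ord (leqnSn n.+1) i) j.
    rewrite -[X in X%:R]card_ord -sumr_const.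
    by apply: ler_sum => i _; exact: row_ge1.
  by lra.
have last0 : y ord_max 0 = 0.
  apply/eqP; rewrite eq_le y0 andbT (le_trans _ last_le0) //.
  by rewrite (bigD1 0) //= lerDl sumr_ge0.
case: (boolP [exists i, (i != ord_max) && (y i 0 == 1)]).
  by move=> /existsP[i /andP[ni /eqP yi]]; exists i.
(* Otherwise column [0] would vanish, the last row by [last0] and the others by [no1], against its
   sum being 1. *)
move=> /existsPn no1; move: (ysum 0); rewrite big1 => [/esym/eqP|i _].
  by rewrite oner_eq0.
have [->//|ni] := eqVneq i ord_max.
by move: (no1 i); rewrite ni /=; case: (y01 i 0) => // ->; rewrite eqxx.
Qed.

Theorem proposition3 (R : realType) (m : nat) (hm : (1 < m)%N) :
  exists x : 'M[R]_(m, m.-1),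
    fractional_assignment x /\
    forall y : 'M[R]_(m, m.-1), assignment y ->
      exists (i : 'I_m) (t : nat),
        (1 <= t <= m.-1)%N /\
        prefix_discrepancy x y i t >= 1 - 1 / (2 * m%:R - 2).
Proof.
case: m hm => [//|[//|n]] _ /=.
exists (hard_matrix R n); split; first exact: hard_matrix_fractional.
move=> y /assignment_missed_row.
have N0 : n.+1%:R != 0 :> R by rewrite pnatr_eq0.
have -> : 1 - 1 / (2 * n.+2%:R - 2) = 1 - (2 * n.+1%:R)^-1 :> R.
  have -> : 2 * n.+2%:R - 2 = 2 * n.+1%:R :> R.
    by rewrite -[n.+2]addn1 natrD; ring.
  by rewrite div1r.
case=> [] [i /negPf ni yi]; exists i.
- exists n.+1; split; first by rewrite leqnn.
  rewrite /prefix_discrepancy.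
  under eq_bigl do rewrite ltn_ord.
  under eq_bigr do rewrite yi subr0 mxE ni.
  (* Column [0] is split off; the remaining [n] columns contribute $1/(n+1)$ each. *)
  rewrite big_ord_recl /= sumr_const card_ord -[_ *+ n]mulr_natr.
  apply: le_trans (ler_norm _).
  rewrite le_eqVlt; apply/orP; left; apply/eqP.
  move: N0; rewrite -[n.+1]addn1 natrD => N0.
  by field.
- exists 1%N; split=> //.
  rewrite /prefix_discrepancy (big_pred1 0) => [|j]; last first.
    by rewrite ltnS leqn0.
  (* The single term is $1/(2(n+1)) - 1$; [distrC] flips its sign inside the norm. *)
  by rewrite mxE ni eqxx yi distrC ler_norm.
Qed.
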